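(* Let $\rho \colon E \to L$ be a characteristic action of a partial groupoid $L$ such that $E_0$ satisfies the descending chain condition on closed subsets (for the closure operator $\mathrm{cl}_\rho$ associated with $\rho$). If $L$ is not a groupoid, then $\deg(L) = h(\rho)$.
   Context: Let $\Upsilon$ be the category with objects $[n]=\{0,1,\dots,n\}$, $n\ge 0$, and all functions as morphisms. A symmetric set is a functor $X\colon\Upsilon^{\mathrm{op}}\to\mathsf{Set}$; write $X_n=X([n])$. Restricting to order-preserving maps gives its underlying simplicial set, with faces $d_i$ and degeneracies $s_i$. Let $\epsilon_{ij}\colon[1]\to[n]$ send $0\mapsto i$, $1\mapsto j$. A symmetric set $X$ is spiny if for all $n\ge1$ the map $X_n\to\prod_{i=1}^n X_1$, $x\mapsto(\epsilon_{01}^*x,\dots,\epsilon_{n-1,n}^*x)$, is injective. A partial groupoid is a spiny symmetric set. The nerve of a groupoid is regarded as a symmetric set ($n$-simplices are functors from the groupoid with object set $[n]$ and exactly one morphism between any two objects); a partial groupoid ''is a groupoid'' if it is isomorphic to such a nerve. Degree: $I\subset[n]$ is gapped if distinct elements of $I$ differ by at least $2$. For $k\ge1$, a simplicial set $X$ is lower $(2k-1)$-Segal if for every $n$ and every gapped $I\subset[n]$ of cardinality $k+1$, the cube $J\mapsto X_{[n]\setminus J}$ ($J\subseteq I$) is a limit diagram; i.e., for every family $(x_i)_{i\in I}$ in $X_{n-1}$ with $d_ix_j=d_{j-1}x_i$ for all $i<j$ in $I$, there is a unique $x\in X_n$ with $d_ix=x_i$ for all $i\in I$. A symmetric set is lower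 $(2k-1)$-Segal if its underlying simplicial set is. $\deg(X)$ is the least $k\ge1$ such that $X$ is lower $(2k-1)$-Segal, and $\infty$ if there is none. Actions: the star of $x\in X_0$ is the set of all simplices of $X$ (of all dimensions) whose initial vertex is $x$. A map $\rho\colon E\to L$ of partial groupoids is star injective if for every $x\in E_0$ the induced map from the star of $x$ to the star of $\rho(x)$ is injective. A characteristic action (or characteristic map) is a star injective map $\rho\colon E\to L$ with $E$ a groupoid and $\rho$ surjective in every degree. For $f\in L_n$, its domain $\mathrm{D}(f)\subseteq E_0$ is the set of $x\in E_0$ for which there is $\tilde f\in E_n$ with initial vertex $x$ and $\rho(\tilde f)=f$. The closure operator on $E_0$ is $\mathrm{cl}_\rho(A)=\bigcap_{f:\,A\subseteq \mathrm{D}(f)}\mathrm{D}(f)$, over all simplices $f$ of $L$ (of all dimensions), an empty intersection being $E_0$; $A$ is closed if $\mathrm{cl}_\rho(A)=A$. Helly number: let $S$ be a closure space with operator $\mathrm{cl}$ and $\mathrm{cl}(\varnothing)=\varnothing$. A family $(A_i)_{i\in I}$ of nonempty subsets is Helly independent if $\bigcap_J \mathrm{cl}(\bigcup_{j\in J}A_j)=\varnothing$, where $J$ ranges over $I$ and all sets $I\setminus\{i\}$, $i\in I$. $h(S)$ is the maximal size of a finite Helly independent family, with $h(S)=\infty$ if there are such families of arbitrarily large finite size. $h(\rho)$ is the Helly number of $(E_0,\mathrm{cl}_\rho)$; when $L$ is not a groupoid, $\varnothing$ is closed so this is defined. *)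

(* Defs.v *)
From mathcomp Require Import all_boot.
From mathcomp Require Import boolp classical_sets.

Set Implicit Arguments.
Unset Strict Implicit.
Unset Printing Implicit Defensive.

Local Open Scope classical_set_scope.

(* [X n] is X([n]); the object [n] = {0, ..., n} is the ordinal type 'I_n.+1. *)
Record symset := Symset {
  simplices :> nat -> Type;
  act : forall m n, ('I_m.+1 -> 'I_n.+1) -> simplices n -> simplices m;
  act_id : forall n (x : simplices n), act id x = x;
  act_comp : forall l m n (f : 'I_l.+1 -> 'I_m.+1) (g : 'I_m.+1 -> 'I_n.+1)
    (x : simplices n), act (g \o f) x = act f (act g x)
}.

Record symset_hom (X Y : symset) := SymsetHom {
  hom_fun :> forall n, X n -> Y n;
  hom_act : forall m n (f : 'I_m.+1 -> 'I_n.+1) (x : X n),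
    hom_fun (act f x) = act f (hom_fun x)
}.

Definition isomorphic (X Y : symset) : Prop :=
  exists (f : symset_hom X Y) (g : symset_hom Y X),
    (forall n, cancel (f n) (g n)) /\ (forall n, cancel (g n) (f n)).

Definition initial_vertex (X : symset) n : X n -> X 0 :=
  act (fun _ : 'I_1 => ord0 : 'I_n.+1).

Definition eps n (i j : 'I_n.+1) : 'I_2 -> 'I_n.+1 :=
  fun k => if k == ord0 then i else j.

Definition spine (X : symset) n (x : X n) (i : 'I_n) : X 1 :=
  act (eps (inord i) (inord i.+1)) x.

Definition spiny (X : symset) : Prop :=
  forall n, 1 <= n -> forall x y : X n, spine x =1 spine y -> x = y.

Record partial_groupoid := PartialGroupoid {
  pg_symset :> symset;
  pg_spiny : spiny pg_symset
}.

Record groupoid := Groupoid {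
  gob : Type;
  ghom : gob -> gob -> Type;
  gid : forall a, ghom a a;
  gcomp : forall a b c, ghom a b -> ghom b c -> ghom a c;
  ginv : forall a b, ghom a b -> ghom b a;
  gcompA : forall a b c d (u : ghom a b) (v : ghom b c) (w : ghom c d),
    gcomp u (gcomp v w) = gcomp (gcomp u v) w;
  gcomp1l : forall a b (u : ghom a b), gcomp (gid a) u = u;
  gcomp1r : forall a b (u : ghom a b), gcomp u (gid b) = u;
  gcompVl : forall a b (u : ghom a b), gcomp (ginv u) u = gid b;
  gcompVr : forall a b (u : ghom a b), gcomp u (ginv u) = gid a
}.

Record gfunctor (G H : groupoid) := Gfunctor {
  fob : gob G -> gob H;
  fmor : forall a b, ghom a b -> ghom (fob a) (fob b);
  fmor_id : forall a, fmor (gid a) = gid (fob a);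
  fmor_comp : forall a b c (u : ghom a b) (v : ghom b c),
    fmor (gcomp u v) = gcomp (fmor u) (fmor v)
}.

Lemma gfunctor_eq (G H : groupoid) (o : gob G -> gob H)
    (m : forall a b, ghom a b -> ghom (o a) (o b)) i1 i2 c1 c2 :
  @Gfunctor G H o m i1 c1 = @Gfunctor G H o m i2 c2.
Proof. by rewrite (Prop_irrelevance i1 i2) (Prop_irrelevance c1 c2). Qed.

Definition gfunctor_comp (G H K : groupoid)
  (F : gfunctor G H) (F' : gfunctor H K) : gfunctor G K.
Proof.
exists (fun a => fob F' (fob F a)) (fun a b u => fmor F' (fmor F u)).
- by move=> a; rewrite !fmor_id.
- by move=> a b c u v; rewrite !fmor_comp.
Defined.

(* The groupoid with object set [n] and exactly one morphism between any two
   objects. *)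
Definition codiscrete (n : nat) : groupoid.
Proof.
apply: (@Groupoid 'I_n.+1 (fun _ _ => unit) (fun _ => tt)
  (fun _ _ _ _ _ => tt) (fun _ _ _ => tt)) => //.
- by move=> a b [].
- by move=> a b [].
Defined.

Definition codiscrete_map m n (f : 'I_m.+1 -> 'I_n.+1) :
  gfunctor (codiscrete m) (codiscrete n).
Proof. by exists (f : gob (codiscrete m) -> gob (codiscrete n)) (fun _ _ u => u).
Defined.

Definition nerve (G : groupoid) : symset.
Proof.
exists (fun n => gfunctor (codiscrete n) G)
  (fun m n f F => gfunctor_comp (codiscrete_map f) F).
- by move=> n [o m i c]; apply: gfunctor_eq.
- by move=> l m n f g F; apply: gfunctor_eq.
Defined.

Definition is_groupoid (X : symset) : Prop :=
  exists G : groupoid, isomorphic X (nerve G).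

(* Extended natural numbers: [None] stands for infinity. *)
Definition enat := option nat.

Definition least (P : set nat) : enat :=
  match pselect (exists k, `[< P k >]) with
  | left exP => Some (ex_minn exP)
  | right _ => None
  end.

(* The faces of the underlying simplicial set: [lift i] is the order-preserving
   injection [n] -> [n+1] whose image misses i. *)
Definition face (X : symset) n (i : 'I_n.+2) : X n.+1 -> X n :=
  act (lift i : 'I_n.+1 -> 'I_n.+2).

Definition gapped n (I : {set 'I_n.+1}) : Prop :=
  forall i j, i \in I -> j \in I -> i < j -> i.+2 <= j.

(* Lower (2k-1)-Segal, for k >= 1.  The ambient object is [n+2]: a gapped subset
   with k+1 >= 2 elements exists in neither [0] nor [1].  The values x i for i
   outside I are irrelevant. *)
Definition lower_segal (k : nat) (X : symset) : Prop :=
  forall n (I : {set 'I_n.+3}), gapped I -> #|I| = k.+1 ->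
  forall x : 'I_n.+3 -> X n.+1,
    (forall i j, i \in I -> j \in I -> i < j ->
       face (inord i) (x j) = face (inord j.-1) (x i)) ->
    exists! y : X n.+2, forall i, i \in I -> face i y = x i.

Definition deg (X : symset) : enat :=
  least [set k | 1 <= k /\ lower_segal k X].

(* The n-simplices of the star of x. *)
Definition star (X : symset) (x : X 0) n : set (X n) :=
  [set f | initial_vertex f = x].

(* Maps preserve dimension, so injectivity on the star is injectivity in each
   dimension. *)
Definition star_injective (E L : symset) (rho : symset_hom E L) : Prop :=
  forall (x : E 0) n, {in star x (n := n) &, injective (rho n)}.

Definition characteristic (E L : partial_groupoid) (rho : symset_hom E L) : Prop :=
  [/\ is_groupoid E, star_injective rho
    & forall n (f : L n), exists g : E n, rho n g = f].

Definition domain (E L : symset) (rho : symset_hom E L) n (f : L n) : set (E 0) :=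
  [set x | exists2 g : E n, initial_vertex g = x & rho n g = f].

Definition cl (E L : symset) (rho : symset_hom E L) (A : set (E 0)) : set (E 0) :=
  [set x | forall n (f : L n), A `<=` domain rho f -> domain rho f x].

Definition dcc_closed T (c : set T -> set T) : Prop :=
  forall F : nat -> set T,
    (forall i, c (F i) = F i) -> (forall i, F i.+1 `<=` F i) ->
    exists N, forall i, N <= i -> F i = F N.

Definition helly_independent T (c : set T -> set T) m (A : 'I_m -> set T) : Prop :=
  (forall i, A i !=set0) /\
  c (\bigcup_i A i) `&` \bigcap_i c (\bigcup_(j in [set j | j != i]) A j) = set0.

(* The least upper bound of the sizes of Helly independent families; when
   c set0 = set0 the empty family is one, so a finite value is attained. *)
Definition helly_number T (c : set T -> set T) : enat :=
  least [set h | forall m (A : 'I_m -> set T), helly_independent c A -> m <= h].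

(* Main.v *)
Require Import Defs.
From mathcomp Require Import all_boot.
From mathcomp Require Import boolp classical_sets.
From mathcomp Require Import zify.

(** Fix a vertex v of [n].  In a spiny symmetric set an n-simplex is determined
    by its edges f_w from v to the other vertices w.  If rho : E -> L is a
    characteristic action, a family of edges (f_w) of L is the star at v of a
    simplex as soon as the domains D(f_w) have a common point x: lift the edges
    to the star of x and use that E is a groupoid.  Hence the lower
    (2k-1)-Segal condition at a gapped set I, seen from a vertex v outside I,
    says that the D(f_w) have a common point whenever, for every i in I, those
    with w != i do.

    If this fails, points p_i common to the D(f_w), w != i, form a Helly
    independent family of k+1 singletons.  Conversely, let (A_j) be Helly
    independent with more than k members.  The domains containing all but one of
    the A_j have no common point, so by the descending chain condition finitely
    many of them have none; but any k of them have a common point, and for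
    k >= 2 the Segal condition propagates this to all finite families.  For
    k = 1 the edges could have distinct initial vertices; instead, the lower
    1-Segal condition makes L a groupoid, so k = 1 occurs on neither side. *)

Set Implicit Arguments.
Unset Strict Implicit.
Unset Printing Implicit Defensive.

Local Open Scope classical_set_scope.

(** * Edges, vertices and stars of simplices *)

Definition edge (X : symset) n (i j : 'I_n.+1) (s : X n) : X 1 :=
  act (eps i j) s.

Definition vertex (X : symset) n (i : 'I_n.+1) (s : X n) : X 0 :=
  act (fun _ : 'I_1 => i) s.

Definition degenerate (X : symset) (c : X 0) : X 1 := act (fun _ => ord0) c.

Definition flip (X : symset) : X 1 -> X 1 := edge (@ord_max 1) ord0.

Section SymmetricSets.
Variable X : symset.
Implicit Types (m n : nat).

Lemma act_act l m n (f : 'I_l.+1 -> 'I_m.+1) (g : 'I_m.+1 -> 'I_n.+1)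
    (h : 'I_l.+1 -> 'I_n.+1) (s : X n) :
  g \o f =1 h -> act f (act g s) = act h s.
Proof. by move=> /funext <-; rewrite act_comp. Qed.

Lemma edge_act m n (f : 'I_m.+1 -> 'I_n.+1) i j (s : X n) :
  edge i j (act f s) = edge (f i) (f j) s.
Proof. by apply: act_act => k /=; rewrite /eps; case: ifP. Qed.

Lemma vertex_act m n (f : 'I_m.+1 -> 'I_n.+1) i (s : X n) :
  vertex i (act f s) = vertex (f i) s.
Proof. exact: act_act. Qed.

Lemma vertex_edge0 n i j (s : X n) : vertex ord0 (edge i j s) = vertex i s.
Proof. exact: vertex_act. Qed.

Lemma vertex_edge1 n i j (s : X n) : vertex ord_max (edge i j s) = vertex j s.
Proof. exact: vertex_act. Qed.

Lemma edge_diag n i (s : X n) : edge i i s = degenerate (vertex i s).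
Proof.
rewrite /degenerate (act_act (h := eps i i)) // => k.
by rewrite /eps /=; case: ifP.
Qed.

Lemma vertex_id i (c : X 0) : vertex i c = c.
Proof. by rewrite -[RHS]act_id; congr act; apply/funext => k; rewrite !ord1. Qed.

Lemma vertex_degenerate i (c : X 0) : vertex i (degenerate c) = c.
Proof. by rewrite /degenerate vertex_act vertex_id. Qed.

Lemma flip_edge n i j (s : X n) : flip (edge i j s) = edge j i s.
Proof. by rewrite /flip edge_act. Qed.

Lemma edge01 (e : X 1) : edge ord0 ord_max e = e.
Proof.
rewrite -[RHS]act_id /edge; congr act; apply/funext => k; apply/val_inj.
by rewrite /eps; case: k => [[|[|]]].
Qed.

(* Pull back along the sequence v, 0, v, 1, ..., v, n, whose consecutive pairs
   all contain v. *)
Lemma spiny_star (spX : spiny X) n (v : 'I_n.+1) (s t : X n) :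
  (forall w, edge v w s = edge v w t) -> s = t.
Proof.
move=> eqst.
pose f (i : 'I_n.*2.+2) : 'I_n.+1 := if odd i then inord i./2 else v.
pose g (i : 'I_n.+1) : 'I_n.*2.+2 := inord i.*2.+1.
have fg : f \o g =1 id.
  move=> i; rewrite /f /g /= inordK; last by move: (ltn_ord i); lia.
  by rewrite /= odd_double /= uphalf_double inord_val.
suff: act f s = act f t.
  by move=> /(congr1 (act g)); rewrite !(act_act _ fg) !act_id.
apply: spX => // i; rewrite /spine -!/(edge _ _ _) !edge_act /f.
rewrite !inordK; [|exact: ltn_ord i|exact: ltnW (ltn_ord i)].
by rewrite /=; case: (odd i) => //=; rewrite -flip_edge eqst flip_edge.
Qed.

End SymmetricSets.

(** * Filling stars in groupoids *)

Lemma hom_edge (X Y : symset) (h : symset_hom X Y) n i j (s : X n) :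
  h 1 (edge i j s) = edge i j (h n s).
Proof. exact: hom_act. Qed.

Lemma hom_vertex (X Y : symset) (h : symset_hom X Y) n i (s : X n) :
  h 0 (vertex i s) = vertex i (h n s).
Proof. exact: hom_act. Qed.

Lemma isomorphic_bij (X Y : symset) (h : symset_hom X Y) :
  (forall n, injective (h n)) -> (forall n (t : Y n), exists s, h n s = t) ->
  isomorphic X Y.
Proof.
move=> hI hS; pose k n (t : Y n) := projT1 (cid (hS n t)).
have hk n t : h n (k n t) = t by rewrite /k; case: cid.
have kact m n (f : 'I_m.+1 -> 'I_n.+1) (t : Y n) : k m (act f t) = act f (k n t).
  by apply: hI; rewrite hom_act !hk.
by exists h, (SymsetHom kact); split=> n x //=; apply: hI; rewrite hk.
Qed.

(* The n-simplex of the nerve on the arrows (W i)^-1 (W j), for W i with common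
   source a. *)
Definition fan (G : groupoid) (a : gob G) n
  (W : 'I_n.+1 -> {b : gob G & ghom a b}) : nerve G n.
Proof.
exists (fun i : gob (codiscrete n) => projT1 (W i))
  (fun i j _ => gcomp (ginv (projT2 (W i))) (projT2 (W j))).
- by move=> i; rewrite gcompVl.
- by move=> i j k _ _; rewrite gcompA -[X in _ = gcomp X _]gcompA gcompVr gcomp1r.
Defined.

Lemma gfunctor_ext (G H : groupoid) (o : gob G -> gob H)
    (m m' : forall a b, ghom a b -> ghom (o a) (o b)) i1 i2 c1 c2 :
  (forall a b u, m a b u = m' a b u) ->
  @Gfunctor G H o m i1 c1 = @Gfunctor G H o m' i2 c2.
Proof.
move=> eqm; have em : m = m'.
  by do 3![apply: functional_extensionality_dep => ?].
by subst m'; apply: gfunctor_eq.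
Qed.

Lemma gcompKV (G : groupoid) (a b c : gob G) (u : ghom a b) (w : ghom b c) :
  gcomp (ginv u) (gcomp u w) = w.
Proof. by rewrite gcompA gcompVl gcomp1l. Qed.

Lemma fan_act (G : groupoid) (a : gob G) m n (f : 'I_m.+1 -> 'I_n.+1)
    (W : 'I_n.+1 -> {b : gob G & ghom a b}) : act f (fan W) = fan (W \o f).
Proof. exact: gfunctor_eq. Qed.

(** The arrows out of [i0] determine [F]: its arrow from i to j is the inverse of the one from [i0]
    to i, followed by the one from [i0] to j. *)
Lemma fanP (G : groupoid) n (a : gob G) (F : nerve G n) i0 : fob F i0 = a ->
  exists2 W, F = fan W & W i0 = existT _ a (gid a).
Proof.
case: F => o m id1 mC /= oa; subst a.
exists (fun i => existT _ (o i) (m i0 i tt)); last by rewrite -id1.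
apply: gfunctor_ext => i j [] /=.
by rewrite -[LHS](gcompKV (m i0 i tt)) -mC.
Qed.

(** Take the fan on the arrows [g w]. Its arrow at [v] is the identity, so its edges out of [v] are
    the [g w] themselves. *)
Lemma nerve_fill (G : groupoid) n (v : 'I_n.+1) (c : nerve G 0)
    (g : 'I_n.+1 -> nerve G 1) :
  (forall w, vertex ord0 (g w) = c) -> g v = degenerate c ->
  exists s : nerve G n, forall w, edge v w s = g w.
Proof.
move=> gc gv; set a := fob c ord0.
have [C cE C0] := fanP (erefl a).
have /choice[W WP] : forall w, exists b : {b : gob G & ghom a b},
    g w = fan (fun k => if k == ord0 then existT _ a (gid a) else b) /\
    (w = v -> b = existT _ a (gid a)).
  move=> w; have ga : fob (g w) ord0 = a by rewrite /a -(gc w).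
  have [W gW W0] := fanP ga; have [->|/eqP nwv] := eqVneq w v.
    exists (existT _ a (gid a)); split=> //; rewrite gv cE /degenerate fan_act.
    by congr fan; apply/funext => k /=; rewrite C0 if_same.
  exists (W ord_max); split=> //; rewrite gW; congr fan.
  apply/funext => k; case: ifPn => [/eqP-> //|k0]; congr (W _).
  by apply/val_inj; case: k k0 => [[|[|]]].
exists (fan W) => w; rewrite (WP w).1 /edge fan_act; congr fan.
by apply/funext => k /=; rewrite /eps; case: ifP => // _; apply: (WP v).2.
Qed.

Lemma groupoid_fill (E : symset) n (v : 'I_n.+1) (c : E 0) (g : 'I_n.+1 -> E 1) :
  is_groupoid E ->
  (forall w, vertex ord0 (g w) = c) -> g v = degenerate c ->
  exists s : E n, forall w, edge v w s = g w.
Proof.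
case=> G [h [k [hk kh]]] gc gv.
have [||s sP] := @nerve_fill G n v (h 0 c) (fun w => h 1 (g w)).
- by move=> w; rewrite -hom_vertex gc.
- by rewrite gv /degenerate hom_act.
by exists (k n s) => w; rewrite -hom_edge sP hk.
Qed.

(** * Domains and lifts of stars *)

Section Domains.
Variables (E L : symset) (rho : symset_hom E L).

Lemma domain_vertex (x : E 0) n (f : L n) :
  domain rho f x -> vertex ord0 f = rho 0 x.
Proof. by case=> g <- <-; rewrite -hom_vertex. Qed.

Lemma domain_edge n (g : E n) i j : domain rho (edge i j (rho n g)) (vertex i g).
Proof.
by exists (edge i j g); [apply: vertex_edge0 | rewrite hom_edge].
Qed.

Lemma domain_fill (gE : is_groupoid E) (x : E 0) n (v : 'I_n.+1)
    (f : 'I_n.+1 -> L 1) :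
  (forall w, domain rho (f w) x) -> f v = degenerate (rho 0 x) ->
  exists2 s : E n, vertex v s = x & forall w, edge v w (rho n s) = f w.
Proof.
move=> fx fv.
have /choice[g gP] : forall w, exists g : E 1,
    [/\ vertex ord0 g = x, rho 1 g = f w & w = v -> g = degenerate x].
  move=> w; have [->|/eqP nwv] := eqVneq w v.
    (* Filling in [E] needs a degenerate edge at [v], so this lift is chosen by hand and not taken
       from [fx]. *)
    exists (degenerate x); split=> //; first exact: vertex_degenerate.
    by rewrite fv /degenerate hom_act.
  by have [g gx gf] := fx w; exists g.
have [||s sP] := @groupoid_fill E n v x g gE.
- by move=> w; case: (gP w).
- by case: (gP v) => _ _; apply.
exists s => [|w]; last by rewrite -hom_edge sP; case: (gP w).
by rewrite -(vertex_edge0 v v s) sP; case: (gP v).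
Qed.

(** Reduces the simplices of all dimensions in [cl] to edges: the lifted star fills to a simplex
    whose image has the same star as [s]. *)
Lemma domain_star (gE : is_groupoid E) (spL : spiny L) n (s : L n) x :
  (forall w, domain rho (edge ord0 w s) x) -> domain rho s x.
Proof.
move=> sx; have [|t tx tP] := domain_fill (v := ord0) gE sx.
  by rewrite edge_diag -(domain_vertex (sx ord0)) vertex_edge0.
by exists t => //; apply: (spiny_star spL (v := ord0)).
Qed.

End Domains.

(** * Faces, gapped sets and the Segal condition *)

Lemma lift_lift n (i j : 'I_n.+3) (u : 'I_n.+1) : i < j ->
  lift j (lift (inord i : 'I_n.+2) u) = lift i (lift (inord j.-1 : 'I_n.+2) u).
Proof.
move=> ij; apply/val_inj; move: (ltn_ord j) (ltn_ord i) => jn ln /=.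
by rewrite !inordK /bump; lia.
Qed.

Lemma lift_surj n (i v : 'I_n) : v != i -> exists u, lift i u = v.
Proof. by rewrite eq_sym => /unlift_some[u -> _]; exists u. Qed.

Lemma lift_lift_surj n (i j v : 'I_n.+3) : i < j -> v != i -> v != j ->
  exists u : 'I_n.+1, lift j (lift (inord i : 'I_n.+2) u) = v.
Proof.
move=> ij vi /lift_surj[v' jv']; move: vi; rewrite -jv' => {v jv'}.
have {1}-> : i = lift j (inord i : 'I_n.+2).
  by apply/val_inj; move: (ltn_ord j) => jn /=; rewrite inordK /bump; lia.
by rewrite (inj_eq lift_inj) => /lift_surj[u <-]; exists u.
Qed.

(** For i < j in [I], the vertex i + 1 is below j and too close to i to lie in [I]. *)
Lemma gapped_between n (I : {set 'I_n.+1}) : gapped I -> 1 < #|I| ->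
  exists v : 'I_n.+1, v \notin I.
Proof.
move=> gI /card_gt1P[i [j [iI jI]]]; wlog: i j iI jI / i < j.
  move=> th ij; have [| |/val_inj/eqP] := ltngtP i j; [| |by rewrite (negbTE ij)].
    by move/th; apply.
  by move/th; apply=> //; rewrite eq_sym.
move=> ij _; have ltij := gI i j iI jI ij; have jn := ltn_ord j.
exists (inord i.+1); apply/negP => /(gI i _ iI).
by rewrite inordK; lia.
Qed.

Lemma card_gt1_neq (T : finType) (A : {set T}) w : 1 < #|A| ->
  exists2 i, i \in A & i != w.
Proof.
move=> /card_gt1P[i [j [iA jA ij]]]; have [iw|] := eqVneq i w; last by exists i.
by exists j; rewrite // -iw eq_sym.
Qed.

Lemma face_edge (X : symset) n (i : 'I_n.+2) u w (s : X n.+1) :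
  edge u w (face i s) = edge (lift i u) (lift i w) s.
Proof. exact: edge_act. Qed.

(** The given simplices match as faces because their common subfaces have the same star at the
    vertex over [v]. As [I] has two elements, each w lies on a face omitting some i != w, where the
    edge from [v] to w is read off. *)
Lemma segal_fill (L : symset) k n (I : {set 'I_n.+3}) (v : 'I_n.+3)
    (f : 'I_n.+3 -> L 1) :
  spiny L -> 0 < k -> lower_segal k L -> gapped I -> #|I| = k.+1 -> v \notin I ->
  (forall i, i \in I -> exists s : L n.+1, forall u w,
     lift i u = v -> edge u w s = f (lift i w)) ->
  exists s : L n.+2, forall w, edge v w s = f w.
Proof.
move=> spL k0 segL gI cI vI fI.
have neqv i : i \in I -> v != i by apply: contraTneq => <-.
have /choice[s sP] : forall i, exists s : L n.+1, i \in I -> forall u w,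
     lift i u = v -> edge u w s = f (lift i w).
  move=> i; case: (boolP (i \in I)) => [/fI[s sP]|_]; first by exists s.
  (* Default value for i outside [I], where the Segal condition ignores it. *)
  by exists (act (fun _ => ord0) (f ord0)).
have [i j iI jI ij|t [tP _]] := segL n I gI cI s.
  have [u uv] := lift_lift_surj ij (neqv i iI) (neqv j jI).
  apply: (spiny_star spL (v := u)) => w.
  by rewrite !face_edge (sP j) // (sP i) // -lift_lift.
exists t => w; have [|i iI iw] := card_gt1_neq (A := I) w; first by rewrite cI.
have [u uv] := lift_surj (neqv i iI); rewrite eq_sym in iw.
have [w' ww'] := lift_surj iw.
by rewrite -uv -ww' -face_edge tP // sP.
Qed.

(** Converse of [segal_fill]: matching faces prescribe a single edge from [v] to each w, and
    uniqueness comes from [spiny_star]. *)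
Lemma segal_of_fill (L : symset) k n (I : {set 'I_n.+3}) (v : 'I_n.+3)
   (x : 'I_n.+3 -> L n.+1) :
  spiny L -> 0 < k -> #|I| = k.+1 -> v \notin I ->
  (forall i j, i \in I -> j \in I -> i < j ->
     face (inord i) (x j) = face (inord j.-1) (x i)) ->
  (forall f : 'I_n.+3 -> L 1,
    (forall i, i \in I -> forall u w, lift i u = v ->
       edge u w (x i) = f (lift i w)) ->
    exists s : L n.+2, forall w, edge v w s = f w) ->
  exists! y : L n.+2, forall i, i \in I -> face i y = x i.
Proof.
move=> spL k0 cI vI xI fill.
have neqv i : i \in I -> v != i by apply: contraTneq => <-.
have Iw w : exists2 i, i \in I & exists u, lift i u = w.
  have [|i iI iw] := card_gt1_neq (A := I) w; first by rewrite cI.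
  by exists i => //; apply: lift_surj; rewrite eq_sym.
(* Vertices shared by the faces i and j come from the subface omitting both, where [xI] applies. *)
have split_lift (i j : 'I_n.+3) (u u' : 'I_n.+2) :
    i < j -> lift i u = lift j u' ->
    exists z : 'I_n.+1, u' = lift (inord i) z /\ u = lift (inord j.-1) z.
  move=> ij uu'; have [] := @lift_lift_surj _ i j (lift j u') ij.
  - by rewrite -uu' eq_sym neq_lift.
  - by rewrite eq_sym neq_lift.
  move=> z zP; exists z; split; first exact/esym/(lift_inj zP).
  by apply: (lift_inj (h := i)); rewrite uu' -zP lift_lift.
have xij i j u u' w w' : i \in I -> j \in I -> i < j ->
    lift i u = lift j u' -> lift i w = lift j w' ->
    edge u w (x i) = edge u' w' (x j).
  move=> iI jI ij /(split_lift _ _ _ _ ij)[z [-> ->]].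
  move=> /(split_lift _ _ _ _ ij)[y [-> ->]].
  by rewrite -!face_edge xI.
have /choice[f fP] : forall w, exists e : L 1, forall i, i \in I ->
    forall u w', lift i u = v -> lift i w' = w -> edge u w' (x i) = e.
  move=> w; have [i iI [w' iw']] := Iw w; have [u iu] := lift_surj (neqv i iI).
  exists (edge u w' (x i)) => j jI u2 w2 ju2 jw2.
  have [ij|ji|/val_inj eij] := ltngtP i j.
  - by apply/esym/xij; rewrite ?iu ?iw'.
  - by apply: xij; rewrite ?iu ?iw'.
  - subst j; rewrite -iu in ju2; rewrite -iw' in jw2.
    by rewrite (lift_inj ju2) (lift_inj jw2).
have [i iI u w iu|y yP] := fill f; first exact: fP.
exists y; split=> [i iI|y' y'P].
  have [u iu] := lift_surj (neqv i iI); apply: (spiny_star spL (v := u)) => w.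
  by rewrite face_edge iu yP; apply/esym/fP.
apply: (spiny_star spL (v := v)) => w; rewrite yP.
have [i iI [w' iw']] := Iw w; have [u iu] := lift_surj (neqv i iI).
by rewrite -iu -{2}iw' -face_edge y'P //; apply/esym/fP.
Qed.

(** * Lower 1-Segal spiny symmetric sets are groupoids *)

Definition star_fillable (X : symset) n (v : 'I_n.+1) : Prop :=
  forall (c : X 0) (f : 'I_n.+1 -> X 1),
    (forall w, vertex ord0 (f w) = c) -> f v = degenerate c ->
    exists s : X n, forall w, edge v w s = f w.

(** Act by the transposition of [v0] and [v]. *)
Lemma star_fillable_vertex (X : symset) n (v0 v : 'I_n.+1) :
  star_fillable X v0 -> star_fillable X v.
Proof.
move=> fill c f fc fv; pose t w := if w == v then v0 else if w == v0 then v else w.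
have tK w : t (t w) = w.
  rewrite /t; have [->|wv] := eqVneq w v; first by rewrite eqxx; case: eqP.
  have [->|wv0] := eqVneq w v0; first by rewrite eqxx.
  by rewrite (negbTE wv) (negbTE wv0).
have tv : t v = v0 by rewrite /t eqxx.
have [w||s sP] := fill c (f \o t); first exact: fc.
  by rewrite /= -tv tK.
by exists (act t s) => w; rewrite edge_act tv sP /= tK.
Qed.

(** Induction on the dimension. By symmetry v = 1 suffices; it lies in the gap of I = {0, 2}, and
    the faces omitting 0 and 2 are filled by induction. *)
Lemma lower_segal1_fill (L : symset) : spiny L -> lower_segal 1 L ->
  forall n (v : 'I_n.+1), star_fillable L v.
Proof.
move=> spL segL; elim=> [|[|n] IH] v;
  apply: (@star_fillable_vertex _ _ ord0 v) => c f fc f0.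
- by exists c => w; rewrite ord1 edge_diag vertex_id f0.
- exists (f ord_max) => w.
  have [->|w0] := eqVneq w ord0; first by rewrite edge_diag fc f0.
  have -> : w = ord_max by apply/val_inj; case: w w0 => [[|[|]]].
  exact: edge01.
pose v1 : 'I_n.+3 := inord 1; have v1E : v1 = 1 :> nat by rewrite inordK.
pose v2 : 'I_n.+3 := inord 2; have v2E : v2 = 2 :> nat by rewrite inordK.
move: c f fc f0; apply: (@star_fillable_vertex _ _ v1) => c f fc f1.
have neq (i j : 'I_n.+3) : i <> j :> nat -> i != j.
  by move=> ij; apply/eqP => /(congr1 val).
have [|||i iI|s sP] := @segal_fill L 1 n [set ord0; v2]%SET v1 f spL isT segL.
- move=> i j; rewrite !inE => /orP[]/eqP-> /orP[]/eqP->; rewrite ?v2E //=.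
- by rewrite cards2 neq ?v2E.
- by rewrite !inE negb_or !neq ?v1E ?v2E.
- have [u uE] : exists u, lift i u = v1.
    apply: lift_surj; apply: neq; rewrite v1E.
    by move: iI; rewrite !inE => /orP[]/eqP->; rewrite ?v2E.
  have [||s sP] := IH u c (fun w => f (lift i w)) => [w||]; first exact: fc.
    by rewrite -f1; congr f.
  by exists s => u' w; rewrite -uE => /lift_inj->.
by exists s.
Qed.

Section FillableGroupoid.
Variable L : symset.
Hypothesis spL : spiny L.
Hypothesis fillL : forall n (v : 'I_n.+1), star_fillable L v.

Let src (e : L 1) : L 0 := vertex ord0 e.
Let tgt (e : L 1) : L 0 := vertex ord_max e.

Let v0 : 'I_3 := ord0.
Let v1 : 'I_3 := inord 1.
Let v2 : 'I_3 := inord 2.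

Let I3P (w : 'I_3) : [\/ w = v0, w = v1 | w = v2].
Proof.
have vE := inord_val w; case: w vE => [[|[|[|k]]] //= kP] <-.
- by constructor 1; apply/val_inj; rewrite /= inordK.
- by constructor 2.
- by constructor 3.
Qed.

Let v1E : v1 = 1 :> nat. Proof. by rewrite inordK. Qed.
Let v2E : v2 = 2 :> nat. Proof. by rewrite inordK. Qed.

Definition triangle (u w t : L 1) : Prop := exists s : L 2,
  [/\ edge v0 v1 s = u, edge v1 v2 s = w & edge v0 v2 s = t].

Lemma triangle_edge n (s : L n) i j k :
  triangle (edge i j s) (edge j k s) (edge i k s).
Proof.
exists (act (fun l : 'I_3 => nth i [:: i; j; k] l) s).
by rewrite !edge_act v1E v2E.
Qed.

Lemma triangle_src u w t : triangle u w t -> src t = src u.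
Proof. by case=> s [<- _ <-]; rewrite /src !vertex_edge0. Qed.

Lemma triangle_tgt u w t : triangle u w t -> tgt t = tgt w.
Proof. by case=> s [_ <- <-]; rewrite /tgt !vertex_edge1. Qed.

(** Up to flipping [u], the edges [u] and [w] form the star at the middle vertex. *)
Lemma triangle_uniq u w t t' : triangle u w t -> triangle u w t' -> t = t'.
Proof.
move=> [s [s01 s12 <-]] [s' [s01' s12' <-]]; congr edge.
apply: (spiny_star spL (v := v1)) => x; case: (I3P x) => ->.
- by rewrite -!(flip_edge v0) s01 s01'.
- by rewrite !edge_diag -!(vertex_edge1 v0) s01 s01'.
- by rewrite s12 s12'.
Qed.

(** Here [u] and [t] form the star at vertex 0. *)
Lemma triangle_cancel u w w' t : triangle u w t -> triangle u w' t -> w = w'.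
Proof.
move=> [s [s01 <- s02]] [s' [s01' <- s02']]; congr edge.
apply: (spiny_star spL (v := v0)) => x; case: (I3P x) => ->.
- by rewrite !edge_diag -!(vertex_edge0 v0 v1) s01 s01'.
- by rewrite s01 s01'.
- by rewrite s02 s02'.
Qed.

Lemma triangle_ex u w : tgt u = src w -> exists t, triangle u w t.
Proof.
move=> uw; pose f x :=
  if x == v0 then flip u else if x == v1 then degenerate (src w) else w.
have v10 : (v1 == v0) = false by apply/eqP => /(congr1 val); rewrite /= v1E.
have v20 : (v2 == v0) = false by apply/eqP => /(congr1 val); rewrite /= v2E.
have v21 : (v2 == v1) = false by apply/eqP => /(congr1 val); rewrite /= v1E v2E.
have [x||s sP] := fillL (v := v1) (c := src w) (f := f).
- rewrite /f; case: ifP => _; first by rewrite vertex_edge0.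
  by case: ifP => _ //; rewrite vertex_degenerate.
- by rewrite /f v10 eqxx.
exists (edge v0 v2 s), s; split=> //; last by rewrite sP /f v20 v21.
by rewrite -flip_edge sP /f eqxx -{1}[u]edge01 !flip_edge edge01.
Qed.

(** Total for convenience: [u] is a dummy value when no triangle exists. *)
Definition comp (u w : L 1) : L 1 :=
  if pselect (exists t, triangle u w t) is left ex then projT1 (cid ex) else u.

Lemma compP u w : tgt u = src w -> triangle u w (comp u w).
Proof.
by rewrite /comp => /triangle_ex uw; case: pselect => // ex; case: cid.
Qed.

Lemma compE u w t : triangle u w t -> comp u w = t.
Proof.
move=> uwt; apply: (@triangle_uniq u w) => //; apply: compP.
by case: uwt => s [<- <- _]; rewrite /src /tgt vertex_edge0 vertex_edge1.
Qed.

Lemma comp_edge n (s : L n) i j k : comp (edge i j s) (edge j k s) = edge i k s.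
Proof. exact/compE/triangle_edge. Qed.

Lemma src_comp u w : tgt u = src w -> src (comp u w) = src u.
Proof. by move/compP/triangle_src. Qed.

Lemma tgt_comp u w : tgt u = src w -> tgt (comp u w) = tgt w.
Proof. by move/compP/triangle_tgt. Qed.

Lemma comp_inj u w w' : tgt u = src w -> tgt u = src w' ->
  comp u w = comp u w' -> w = w'.
Proof.
move=> /compP uw /compP uw' E; rewrite E in uw; exact: triangle_cancel uw uw'.
Qed.

Lemma comp_edge_cancel n (s : L n) i j k w : tgt (edge i j s) = src w ->
  comp (edge i j s) w = edge i k s -> edge j k s = w.
Proof.
move=> ijw E; apply: comp_inj (ijw) _; last by rewrite E comp_edge.
by rewrite /src /tgt vertex_edge0 vertex_edge1.
Qed.

(** Fill the star u, uv, (uv)w at vertex 0 of a 3-simplex. Left cancellation identifies the edges 12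
    and 23 as v and w, so 13 is vw and 03 is also u(vw). *)
Lemma compA u v w : tgt u = src v -> tgt v = src w ->
  comp u (comp v w) = comp (comp u v) w.
Proof.
move=> uv vw; pose r := [:: degenerate (src u); u; comp u v; comp (comp u v) w].
have uvw : tgt (comp u v) = src w by rewrite tgt_comp.
have [x||s sP] := fillL (v := ord0 : 'I_4) (c := src u)
  (f := fun k => nth u r k) => //.
  case: x => [[|[|[|[|]]]]] //= _; first by rewrite vertex_degenerate.
    exact: src_comp.
  by rewrite -!/(src _) !src_comp.
have {}sP k (kP : k < 4) : edge ord0 (Ordinal kP) s = nth u r k by rewrite sP.
have s1 := sP 1 isT; have s2 := sP 2 isT; have s3 := sP 3 isT; rewrite /= in s1 s2 s3.
have s12 := @comp_edge_cancel _ s ord0 (@Ordinal 4 1 isT) (@Ordinal 4 2 isT) v.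
have s23 := @comp_edge_cancel _ s ord0 (@Ordinal 4 2 isT) (@Ordinal 4 3 isT) w.
by rewrite -{1}s12 ?s1 ?s2 // -{1}s23 ?s2 ?s3 // comp_edge -{1}s1 comp_edge s3.
Qed.

Definition arrow (a b : L 0) : Type := {e : L 1 | src e = a /\ tgt e = b}.

Lemma arrow_eq a b (u w : arrow a b) : sval u = sval w -> u = w.
Proof.
by case: u w => [u up] [w wp] /= uw; subst w; rewrite (Prop_irrelevance up wp).
Qed.

Lemma arrow_src a b (u : arrow a b) : src (sval u) = a.
Proof. by case: (svalP u). Qed.

Definition arrow_id a : arrow a a.
Proof. by exists (degenerate a); rewrite /src /tgt !vertex_degenerate. Defined.

Lemma arrow_compatible a b c (u : arrow a b) (w : arrow b c) :
  tgt (sval u) = src (sval w).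
Proof. by case: u w => [u [_ ub]] [w [wb _]] /=; rewrite ub wb. Qed.

Definition arrow_comp a b c (u : arrow a b) (w : arrow b c) : arrow a c.
Proof.
exists (comp (sval u) (sval w)); have uw := arrow_compatible u w.
by rewrite src_comp // tgt_comp //; split; [case: (svalP u) | case: (svalP w)].
Defined.

Definition arrow_inv a b (u : arrow a b) : arrow b a.
Proof.
exists (flip (sval u)); rewrite /src /tgt vertex_edge0 vertex_edge1.
by case: (svalP u).
Defined.

Definition edge_groupoid : groupoid.
Proof.
apply: (@Groupoid (L 0) arrow arrow_id arrow_comp arrow_inv).
- move=> a b c d u v w; apply/arrow_eq/compA; exact: arrow_compatible.
- move=> a b [u [ua ub]]; subst a b; apply: arrow_eq => /=.
  by rewrite /src -edge_diag -{2}[u]edge01 comp_edge edge01.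
- move=> a b [u [ua ub]]; subst a b; apply: arrow_eq => /=.
  by rewrite /tgt -edge_diag -{1}[u]edge01 comp_edge edge01.
- move=> a b [u [ua ub]]; subst a b; apply: arrow_eq => /=.
  by rewrite /tgt -edge_diag -{2}[u]edge01 comp_edge.
- move=> a b [u [ua ub]]; subst a b; apply: arrow_eq => /=.
  by rewrite /src -edge_diag -{1}[u]edge01 comp_edge.
Defined.

Lemma nerve_edge_eq n (F F' : nerve edge_groupoid n) :
  (forall i j : 'I_n.+1, sval (@fmor _ _ F i j tt) = sval (@fmor _ _ F' i j tt)) ->
  F = F'.
Proof.
case: F F' => [o m i1 c1] [o' m' i2 c2] /= eqm.
(* The objects are recovered as sources of the edges [m i i]. *)
have eo : o = o'.
  by apply/funext => i; have := arrow_src (m i i tt); rewrite eqm arrow_src.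
by subst o'; apply: gfunctor_ext => i j []; apply: arrow_eq.
Qed.

Definition nerve_edges n (s : L n) : nerve edge_groupoid n.
Proof.
exists (fun i : gob (codiscrete n) => vertex i s : gob edge_groupoid)
  (fun i j _ =>
     exist _ (edge i j s) (conj (vertex_edge0 i j s) (vertex_edge1 i j s))).
- by move=> i; apply: arrow_eq; rewrite /= edge_diag.
- by move=> i j k _ _; apply: arrow_eq; rewrite /= comp_edge.
Defined.

Lemma nerve_edges_act m n (f : 'I_m.+1 -> 'I_n.+1) (s : L n) :
  nerve_edges (act f s) = act f (nerve_edges s).
Proof. by apply: nerve_edge_eq => i j /=; rewrite edge_act. Qed.

(** For surjectivity of [nerve_edges], fill the star of [F] at vertex 0; its other edges follow by
    left cancellation. *)
Lemma fillable_groupoid : is_groupoid L.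
Proof.
exists edge_groupoid; apply: (isomorphic_bij (h := SymsetHom nerve_edges_act)) => n /=.
  move=> s t /(congr1 (fun F : nerve edge_groupoid n =>
    fun i j => sval (@fmor _ _ F i j tt))) st.
  by apply: (spiny_star spL (v := ord0)) => w; apply: (congr1 (fun h => h ord0 w) st).
move=> F; pose a := fob F (ord0 : gob (codiscrete n)).
have [w||s sP] := fillL (v := ord0) (c := a)
    (f := fun w : 'I_n.+1 => sval (@fmor _ _ F (ord0 : gob (codiscrete n)) w tt)).
- by case: (svalP (@fmor _ _ F (ord0 : gob (codiscrete n)) w tt)).
- by have := fmor_id F (ord0 : gob (codiscrete n)) => /(congr1 sval).
exists s; apply: nerve_edge_eq => i j /=.
have Fij := fmor_comp F (tt : @ghom (codiscrete n) ord0 i)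
  (tt : @ghom (codiscrete n) i j).
apply: (@comp_edge_cancel _ s ord0); rewrite !sP; first exact: arrow_compatible.
by rewrite -[LHS]/(sval (gcomp (fmor F _) (fmor F _))) -Fij.
Qed.

End FillableGroupoid.

(** * Helly independence and the lower Segal conditions *)

Lemma dependent_choice_seq T (P : seq T -> T -> Prop) :
  (forall s, exists x, P s x) -> exists e : nat -> T, forall n, P (mkseq e n) (e n).
Proof.
move=> /choice[g gP]; pose s := fun n => iter n (fun s => rcons s (g s)) [::].
exists (fun n => g (s n)) => n; suff -> : mkseq (fun n => g (s n)) n = s n by [].
by elim: n => // n IH; rewrite mkseqS IH.
Qed.

Section Helly.
Variables (E L : symset) (rho : symset_hom E L).
Hypotheses (gE : is_groupoid E) (spL : spiny L).
Hypothesis rho_surj : forall n (f : L n), exists g : E n, rho n g = f.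

Lemma helly_lower_segal k : 0 < k ->
  (forall m (A : 'I_m -> set (E 0)), helly_independent (cl rho) A -> m <= k) ->
  lower_segal k L.
Proof.
move=> k0 hk n I gI cI x xI.
have [|v vI] := gapped_between gI; first by rewrite cI.
have neqv i : i \in I -> v != i by apply: contraTneq => <-.
apply: (segal_of_fill spL k0 cI vI xI) => f fx.
(* In a lift of [x i] to [E], the vertex over [v] lies in the domain of every [f w] with w != i. *)
have /choice[p pP] : forall i, exists p : E 0, i \in I -> forall w,
    w != i -> domain rho (f w) p.
  move=> i; have [g gP] := rho_surj (x i).
  case: (boolP (i \in I)) => iI; last by exists (vertex ord0 g).
  have [u iu] := lift_surj (neqv i iI).
  exists (vertex u g) => _ w /lift_surj[w' <-].
  by rewrite -(fx i iI u w' iu) -gP; apply: domain_edge.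
(* The family is indexed by [I], so it has size k + 1 even if some points [p i] coincide. *)
pose A (t : 'I_#|I|) : set (E 0) := [set p (enum_val t)].
have hA : ~ helly_independent (cl rho) A.
  by move=> /hk; rewrite cI ltnn.
have [z [zA zAj]] : exists z, (cl rho (\bigcup_i A i) `&`
    \bigcap_i cl rho (\bigcup_(j in [set j | j != i]) A j)) z.
  apply: contrapT => nz; apply: hA; split=> [t|]; first by exists (p (enum_val t)).
  by apply/seteqP; split=> // z zP; case: nz; exists z.
(* The domain of [f w] can miss at most [p w], so for w in [I] the closure omitting the index w is
   used. *)
have fz w : domain rho (f w) z.
  case: (boolP (w \in I)) => wI.
    apply: (zAj (enum_rank_in wI w)) => // _ [t /= tw ->].
    apply: pP; first exact: enum_valP.
    by apply: contraNneq tw => wt; apply/eqP/enum_val_inj; rewrite enum_rankK_in.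
  apply: zA => _ [t _ ->]; apply: pP; first exact: enum_valP.
  by apply: contraNneq wI => ->; apply: enum_valP.
have [i iI] : exists i, i \in I by apply/card_gt0P; rewrite cI.
have [u iu] := lift_surj (neqv i iI).
have [|s _ sP] := domain_fill (v := v) gE fz; last by exists (rho n.+2 s).
rewrite -(domain_vertex (fz v)).
have <- : edge u u (x i) = f v by rewrite (fx i iI u u iu) iu.
by rewrite edge_diag vertex_degenerate.
Qed.

Lemma helly_step k N (e : 'I_N -> L 1) : 1 < k -> lower_segal k L -> k < N ->
  (forall j, exists x, forall i, i != j -> domain rho (e i) x) ->
  exists x, forall i, domain rho (e i) x.
Proof.
case: N e => [|[|[|n]]] e k1 segL kN /choice[q qP]; try lia.
pose c := rho 0 (q ord0).
(* Since N >= 3, some i differs from both j and 0; then [q j] and [q ord0] both lie over the initial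
   vertex of [e i]. This uses k > 1. *)
have qc j : rho 0 (q j) = c.
  have [i] : exists2 i, i \in [set~ j]%SET & i != ord0.
    by apply: card_gt1_neq; rewrite cardsC1 card_ord.
  rewrite !inE => ij i0.
  by rewrite /c -(domain_vertex (qP j i ij)) (domain_vertex (qP ord0 i i0)).
(* Place the edges e_i at the even positions 2i and fill the odd positions with
   degenerate edges, so that v = 1 and I = {0, 2, ..., 2k} is gapped. *)
pose f (p : 'I_(n.*2.+3).+3) : L 1 :=
  if odd p then degenerate c else e (inord p./2).
pose h (j : 'I_k.+1) : 'I_(n.*2.+3).+3 := inord j.*2.
have hE (j : 'I_k.+1) : h j = j.*2 :> nat by rewrite inordK //; have := ltn_ord j; lia.
pose I := [set h j | j : 'I_k.+1]%SET.
have hI : injective h.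
  by move=> i j /(congr1 val); rewrite /= !hE => ij; apply/val_inj => /=; lia.
pose v : 'I_(n.*2.+3).+3 := inord 1.
have vE : v = 1 :> nat by rewrite inordK.
have fv : f v = degenerate c by rewrite /f vE.
have domf (p : 'I_(n.*2.+3).+3) x : rho 0 x = c ->
    (~~ odd p -> domain rho (e (inord p./2)) x) -> domain rho (f p) x.
  rewrite /f => xc; case: ifP => [_ _|_ ep]; last exact: ep.
  rewrite -(vertex_degenerate ord0 x) -xc.
  by exists (degenerate x); rewrite // /degenerate hom_act.
have [||||i|s sP] := @segal_fill L k _ I v f spL _ segL.
- by lia.
- move=> _ _ /imsetP[i _ ->] /imsetP[j _ ->]; rewrite !hE; lia.
- by rewrite card_imset // card_ord.
- by apply/imsetP => -[j _ /(congr1 val)]; rewrite /= vE hE; lia.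
- move=> /imsetP[j _ ->].
  have [u iu] : exists u, lift (h j) u = v.
    (* Position 1 is odd, hence never an omitted position 2j. *)
    by apply: lift_surj; apply/eqP => /(congr1 val); rewrite /= vE hE; lia.
  (* The face omitting position 2j avoids the edge [e j], and [q j] lies in the domains of all the
     others. *)
  have [w||s _ sP] := @domain_fill _ _ rho gE (q (inord j)) _ u
    (fun w => f (lift (h j) w)).
  - apply: domf => [|ow]; first exact: qc.
    apply: qP; move: (neq_lift (h j) w) ow; move: (lift (h j) w) => p hp op.
    apply: contraNneq hp => /(congr1 val) pj; apply/eqP/val_inj; move: pj => /=.
    by have jk := ltn_ord j; have pn := ltn_ord p; rewrite (hE j) !inordK; lia.
  - by rewrite qc -fv; congr f.
  by exists (rho _ s) => u' w; rewrite -iu => /lift_inj->; apply: sP.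
(* In a lift of [s], the vertex over [v] lies in the domain of every [e i]. *)
have [g gs] := rho_surj s; exists (vertex v g) => i.
have [p pE] : exists p : 'I_(n.*2.+3).+3, p = i.*2 :> nat.
  by exists (inord i.*2); rewrite inordK //; have := ltn_ord i; lia.
have -> : e i = f p by rewrite /f pE odd_double half_double inord_val.
by rewrite -sP -gs; apply: domain_edge.
Qed.

Lemma sub_cl (A : set (E 0)) : A `<=` cl rho A.
Proof. by move=> x Ax n f; apply. Qed.

(** Otherwise choose edges in [P] successively, each domain missing a point of the intersection of
    the earlier ones. These intersections are closed and descend strictly forever. *)
Lemma dcc_finite_cap (P : set (L 1)) : dcc_closed (cl rho) -> P !=set0 ->
  (forall m (e : 'I_m -> L 1), (forall i, P (e i)) ->
     exists x, forall i, domain rho (e i) x) ->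
  exists x, forall f, P f -> domain rho f x.
Proof.
move=> dcc [f0 Pf0] capP; apply: contrapT => ncap.
have [|e eP] := @dependent_choice_seq _ (fun s f => P f /\
    ((forall i, i < size s -> P (nth f0 s i)) -> exists2 x,
      forall i, i < size s -> domain rho (nth f0 s i) x & ~ domain rho f x)).
  move=> s.
  have [sP|sP] := pselect (forall i, i < size s -> P (nth f0 s i));
    last by exists f0.
  have [x xs] := capP (size s) (fun i => nth f0 s i) (fun i => sP i (ltn_ord i)).
  have [f [Pf fx]] : exists f, P f /\ ~ domain rho f x.
    apply: contrapT => nf; apply: ncap; exists x => f Pf.
    by apply: contrapT => fx; apply: nf; exists f.
  exists f; split=> // _; exists x => // i si; exact: xs (Ordinal si).
have eP1 n : P (e n) by case: (eP n).
pose F n := [set x | forall i, i < n -> domain rho (e i) x].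
have [i|i x Fx j ji|N FN] := dcc F.
- apply/seteqP; split; last exact: sub_cl.
  by move=> x xF j ji; apply: xF => y; apply.
- by apply: Fx; apply: ltnW.
have nthE i : i < N -> nth f0 (mkseq e N) i = e i by move=> iN; rewrite nth_mkseq.
have [_] := eP N; rewrite size_mkseq => -[i iN|x xN]; first by rewrite nthE.
apply; have : F N x by move=> i iN; rewrite -nthE //; apply: xN.
by rewrite -(FN N.+1) //; apply.
Qed.

(* A domain containing all the A j but one contains all the points p j but one,
   hence fewer than m such domains have a common point. *)
Lemma lower_segal_helly k m (A : 'I_m -> set (E 0)) :
  dcc_closed (cl rho) -> 1 < k -> lower_segal k L ->
  helly_independent (cl rho) A -> m <= k.
Proof.
move=> dcc k1 segL [A0 indA]; rewrite leqNgt; apply/negP => km.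
have /choice[p pP] : forall i, exists x, A i x by move=> i; have [x] := A0 i; exists x.
pose P (f : L 1) := exists t, forall j, j != t -> A j `<=` domain rho f.
pose t0 : 'I_m := Ordinal (ltn_trans (ltnW k1) km).
(* By [domain_star], such a point would lie in every closure of [indA]: if a domain contains all the
   [A j], or all but one, then the edges of its simplex from vertex 0 are in [P]. *)
have cap_P : ~ exists x, forall f, P f -> domain rho f x.
  case=> x xP; suff : (set0 : set (E 0)) x by [].
  rewrite -indA; split=> [|t _] n f fA; apply: (domain_star gE spL) => w; apply: xP.
    exists t0 => j _ y Ajy; have [g gy <-] : domain rho f y by apply: fA; exists j.
    by rewrite -gy; apply: domain_edge.
  exists t => j jt y Ajy; have [g gy <-] : domain rho f y by apply: fA; exists j.
  by rewrite -gy; apply: domain_edge.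
apply: (cap_P); apply: dcc_finite_cap => //.
  apply: contrapT => P0; apply: cap_P; exists (p t0) => f Pf.
  by case: P0; exists f.
(* Induction on the number of edges: pigeonhole up to k of them, [helly_step] beyond. *)
elim=> [|n IH] e eP; first by exists (p t0) => -[].
have [nk|kn] := leqP n.+1 k; last first.
  apply: (helly_step k1 segL kn) => j.
  have [x xP] := IH (e \o lift j) (fun i => eP _); exists x => i /lift_surj[i' <-].
  exact: xP.
have /choice[t tP] := eP.
(* Only [A (t i)] may fail to lie in the domain of [e i]. As n + 1 <= k < m, some j is no [t i], and
   [p j] is a common point. *)
have [j jt] : exists j, j \notin codom t.
  apply/existsP; rewrite -negb_forall; apply/negP => /forallP tS.
  have : m <= n.+1; last by rewrite leqNgt (leq_ltn_trans nk km).
  rewrite -[m in m <= _]card_ord -[n.+1]card_ord -(size_codom t).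
  apply: leq_trans (card_size _); apply/subset_leq_card/fintype.subsetP => j _.
  exact: tS.
exists (p j) => i; apply: (tP i j); last exact: pP.
by apply: contraNneq jt => ->; apply: codom_f.
Qed.

End Helly.

Theorem theorem1p3 (E L : partial_groupoid) (rho : symset_hom E L) :
  characteristic rho ->
  dcc_closed (cl rho) ->
  ~ is_groupoid L ->
  deg L = helly_number (cl rho).
Proof.
case=> gE _ surj dcc nL; have spL := @pg_spiny L.
have nsegL : ~ lower_segal 1 L.
  by move=> segL; apply: nL; apply: fillable_groupoid (lower_segal1_fill spL segL).
(* Both numbers are least elements, so it suffices that the two sets agree. *)
rewrite /deg /helly_number; congr least; apply/seteqP; split=> k /=.
  case=> k0 segL m A; apply: (lower_segal_helly gE spL surj dcc _ segL).
  by case: k k0 segL => [|[|k]].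
move=> hk; have k0 : 0 < k.
  (* If 0 bounds the Helly independent families, so does 1, which would make [L] lower 1-Segal. *)
  case: k hk => // h0; case: nsegL; apply: (helly_lower_segal gE spL surj) => // m A.
  by move/h0; case: m A.
by split=> //; apply: (helly_lower_segal gE spL surj).
Qed.
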